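(* Let $H$ be a bipartite graph on $h$ vertices. Let $m\in\mathbb{N}$ and let $n$ be given by $2n=mh$; below, $G$ denotes a balanced bipartite graph on $2n=mh$ vertices. (1) If $hcf(H)\neq 1$, then there exists a $G$ such that $\delta(G)=\lceil \frac{n}{2}\rceil-1$ and $G$ does not contain an $H$-factor. (2) If $hcf(H)=1$, then there exists a $G$ such that $\delta(G)=\left(1-\frac{1}{\chi_{cr}(H)}\right)n-1$ and $G$ does not contain an $H$-factor.
   Context: A bipartite graph is balanced if its two partition sets have the same size (so $G$ has $n$ vertices in each partition set). $\delta(G)$ is the minimum degree of $G$. For a graph $H$ on $h$ vertices and a graph $G$ on $N$ vertices, an $H$-factor of $G$ is a subgraph of $G$ consisting of $\lfloor N/h\rfloor$ vertex-disjoint copies of $H$. The bipartite graph $H$ is understood to have chromatic number $\chi(H)=2$. $\sigma(H)$ is the size of the smallest color class over all proper 2-colorings of $H$, and $\chi_{cr}(H)=\frac{(\chi(H)-1)h}{h-\sigma(H)}=\frac{h}{h-\sigma(H)}$; thus $1-1/\chi_{cr}(H)=\sigma(H)/h$. $hcf_c(H)$ is the highest common factor of the numbers of vertices of the connected components of $H$. For a proper 2-coloring of $H$ with color classes of sizes $x_1\le x_2$ consider the difference $x_2-x_1$; let $D(H)$ be the set of these differences over all proper 2-colorings of $H$. $hcf_\chi(H)$ is the highest common factor of the elements of $D(H)$, with $hcf_\chi(H)=\infty$ if $D(H)=\{0\}$. For bipartite $H$ (that is, $\chi(H)=2$), one says $hcf(H)=1$ if and only if both $hcf_c(H)=1$ and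 $hcf_\chi(H)\le 2$; otherwise $hcf(H)\neq 1$.
   Formalization: In (2) the minimum degree is ⌈(1−1/χ_cr(H))n⌉−1: without rounding the value may be a non-integer (H = K_{1,2} plus an isolated vertex, m=1 gives −1/2), so no G exists; when (1−1/χ_cr(H))n is an integer nothing changes. Also m≥1, since m=0 would require degree −1. *)

(* Defs.v *)
From mathcomp Require Import all_boot all_order all_algebra.

Set Implicit Arguments.
Unset Strict Implicit.
Unset Printing Implicit Defensive.

Import Order.TTheory GRing.Theory Num.Theory.

Record sgraph := SGraph {
  vertex :> finType;
  edge : rel vertex;
  edge_sym : symmetric edge;
  edge_irr : irreflexive edge }.

Definition degree (G : sgraph) (x : G) : nat := #|[set y | edge x y]|.

(* Every degree is below #|G|, so the default value of the bigop is only seen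
   on the graph without vertices. *)
Definition min_degree (G : sgraph) : nat :=
  \big[minn/#|G|]_(x : G) degree x.

Definition independent (G : sgraph) (A : {set G}) : bool :=
  [forall x in A, forall y in A, ~~ edge x y].

Definition balanced_bipartite (G : sgraph) : Prop :=
  exists A : {set G}, [/\ independent A, independent (~: A) & #|A| = #|~: A|].

Definition proper_coloring (G : sgraph) (k : nat) (f : {ffun G -> 'I_k}) : bool :=
  [forall x, forall y, edge x y ==> (f x != f y)].

Definition colorable (G : sgraph) (k : nat) : bool :=
  [exists f : {ffun G -> 'I_k}, proper_coloring f].

Lemma ex_colorable (G : sgraph) : exists k, colorable G k.
Proof.
exists #|G|; apply/existsP; exists [ffun x => enum_rank x].
apply/forallP => x; apply/forallP => y; apply/implyP => exy.
rewrite !ffunE (inj_eq enum_rank_inj); apply/eqP => eq_xy.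
by rewrite eq_xy edge_irr in exy.
Qed.

Definition chromatic_number (G : sgraph) : nat := ex_minn (ex_colorable G).

Definition color_class (G : sgraph) (k : nat) (f : {ffun G -> 'I_k}) (c : 'I_k) :
  {set G} := [set x | f x == c].

(* The default value #|H| is only seen when H has no proper 2-coloring. *)
Definition sigma (H : sgraph) : nat :=
  \big[minn/#|H|]_(f : {ffun H -> 'I_2} | proper_coloring f)
    \big[minn/#|H|]_(c : 'I_2) #|color_class f c|.

Definition chi_cr (H : sgraph) : rat :=
  (((chromatic_number H)%:R - 1) * #|H|%:R / (#|H|%:R - (sigma H)%:R))%R.

Definition components (H : sgraph) : {set {set H}} :=
  equivalence_partition (connect (@edge H)) [set: H].

Definition hcf_c (H : sgraph) : nat :=
  \big[gcdn/0]_(C in components H) #|C|.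

Definition class_diff (H : sgraph) (f : {ffun H -> 'I_2}) : nat :=
  let a := #|color_class f ord0| in
  let b := #|color_class f ord_max| in
  maxn a b - minn a b.

(* The set D(H), as a duplicate-free sequence. *)
Definition diff_set (H : sgraph) : seq nat :=
  undup [seq class_diff f | f : {ffun H -> 'I_2} in [pred f | proper_coloring f]].

(* None stands for infinity. *)
Definition hcf_chi (H : sgraph) : option nat :=
  if diff_set H == [:: 0] then None
  else Some (\big[gcdn/0]_(d <- diff_set H) d).

Definition hcf_chi_le (H : sgraph) (k : nat) : bool :=
  if hcf_chi H is Some d then d <= k else false.

(* The property "hcf(H) = 1", which is only meant for graphs H of chromatic
   number 2. *)
Definition hcf_eq1 (H : sgraph) : bool := (hcf_c H == 1) && hcf_chi_le H 2.

Definition copy_of (H G : sgraph) (f : H -> G) : Prop :=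
  injective f /\ forall x y, edge x y -> edge (f x) (f y).

Definition has_factor (H G : sgraph) : Prop :=
  exists phi : 'I_(#|G| %/ #|H|) -> H -> G,
    (forall i, copy_of (phi i)) /\
    (forall i j, i != j -> [disjoint codom (phi i) & codom (phi j)]).

(* Main.v *)
Require Import Defs.
From mathcomp Require Import all_boot all_order all_algebra.
From mathcomp Require Import zify ring lra.

Set Implicit Arguments.
Unset Strict Implicit.
Unset Printing Implicit Defensive.

Import Order.TTheory GRing.Theory Num.Theory.

(* Every extremal graph is a disjoint union of two complete bipartite graphs
   K(a, b) and K(n - a, n - b), with a the required minimum degree. A factor
   tiles the whole vertex set, and each tile inherits any bipartition of G.
   - If hcf_c(H) <> 1, then hcf_c(H) divides the size a + b of the first part;
     b is chosen so that it does not.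
   - If D(H) has gcd d > 2, or D(H) = {0} (d = 0), take b = a + 1. G has a
     bipartition, obtained by swapping the sides of one of the two parts, whose
     class sizes differ by 2; they should be congruent modulo d.
   - In general take b = n - a. The same bipartition now has a class of 2a
     vertices, which contains at least sigma(H) vertices of each of the m tiles,
     whereas 2a < m sigma(H). *)

(** * Cardinalities and rounding *)

Lemma card_bool_prod (T : finType) (P : pred (bool * T)) :
  #|[set x | P x]| = #|[set i | P (true, i)]| + #|[set i | P (false, i)]|.
Proof.
rewrite -!sum1dep_card [LHS](eq_bigl (fun x => predT x.1 && P (x.1, x.2))).
  by rewrite -(pair_big_dep predT (fun s i => P (s, i)) (fun _ _ => 1)) big_bool.
by case.
Qed.

Lemma card_ord_lt (n a : nat) : a <= n -> #|[set i : 'I_n | i < a]| = a.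
Proof.
move=> le_an; rewrite -sum1dep_card (big_ord_narrow le_an).
by rewrite sum1_card card_ord.
Qed.

Lemma card_ord_ge (n a : nat) : a <= n -> #|[set i : 'I_n | ~~ (i < a)]| = n - a.
Proof.
move=> le_an; have -> : [set i : 'I_n | ~~ (i < a)] = ~: [set i : 'I_n | i < a].
  by apply/setP=> i; rewrite !inE.
by rewrite cardsCs setCK card_ord card_ord_lt.
Qed.

(** With t - 1 = 2q + r and r at most 1, t / 2 lies in the interval ]q, q + 1]. Both required
    minimum degrees have this form, with t = n and t = m sigma(H). *)
Lemma ceil_half (t : nat) :
  0 < t -> ((t.-1./2)%:Z = Num.ceil (t%:R / 2%:R : rat) - 1)%R.
Proof.
move=> t_gt0; rewrite (@ceil_def _ _ (Posz t.-1./2.+1)); first by lia.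
have -> : (Posz t.-1./2.+1 - 1)%R = Posz t.-1./2 by lia.
rewrite -!pmulrn; have t_eq := odd_double_half t.-1.
have : (t%:R : rat)%R = ((odd t.-1)%:R + (t.-1./2)%:R * 2 + 1)%R.
  by rewrite -natrM -natrD -[1%R]/(1%:R)%R -natrD; congr (_%:R)%R; lia.
move=> ->; rewrite -[((t.-1)./2.+1)%:R%R]natr1.
by case: (odd t.-1); apply/andP; split; rewrite ?mulr1n ?mulr0n; lra.
Qed.

(** * Bipartitions and components of H *)

Section Bipartitions.
Variable H : sgraph.
Implicit Types A C : {set H}.

Lemma independentP A :
  reflect (forall x y, x \in A -> y \in A -> ~~ edge x y) (independent A).
Proof.
apply: (iffP forall_inP) => [indA x y xA yA | indA x xA].
  exact: (forall_inP (indA x xA)).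
by apply/forall_inP=> y yA; apply: indA.
Qed.

Lemma coloringP (k : nat) (f : {ffun H -> 'I_k}) :
  reflect (forall x y, edge x y -> f x != f y) (proper_coloring f).
Proof.
apply: (iffP forallP) => [cf x y | cf x]; first by have /forallP/(_ y)/implyP := cf x.
by apply/forallP=> y; apply/implyP; apply: cf.
Qed.

Lemma bipartition_coloring A :
    independent A -> independent (~: A) ->
  exists f : {ffun H -> 'I_2},
    [/\ proper_coloring f, color_class f ord0 = A & color_class f ord_max = ~: A].
Proof.
move=> /independentP indA /independentP indC.
exists [ffun x => if x \in A then ord0 else ord_max]; split.
- apply/coloringP=> x y exy; rewrite !ffunE.
  have := indA x y; have := indC x y; rewrite !inE exy.
  by case: (x \in A); case: (y \in A) => // h1 h2;
    [have := h2 isT isT | have := h1 isT isT].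
- by apply/setP=> x; rewrite !inE ffunE; case: (x \in A).
- by apply/setP=> x; rewrite !inE ffunE; case: (x \in A).
Qed.

Lemma sigma_le_color_class (f : {ffun H -> 'I_2}) (c : 'I_2) :
  proper_coloring f -> sigma H <= #|color_class f c|.
Proof.
move=> cf; rewrite /sigma.
apply: leq_trans (bigmin_le_cond #|H| _ cf) _.
exact: (bigmin_le_cond #|H| (fun c => #|color_class f c|) (isT : xpredT c)).
Qed.

Lemma sigma_le_bipartition A :
  independent A -> independent (~: A) -> sigma H <= #|A|.
Proof.
move=> iA iC; have [f [cf <- _]] := bipartition_coloring iA iC.
exact: sigma_le_color_class.
Qed.

Lemma card_color_classes (f : {ffun H -> 'I_2}) :
  #|color_class f ord0| + #|color_class f ord_max| = #|H|.
Proof.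
have -> : color_class f ord_max = ~: color_class f ord0; last exact: cardsC.
by apply/setP=> x; rewrite !inE; case: (f x) => [[|[|?]] ?].
Qed.

(** The infinite case is encoded by d = 0: 0 divides only 0, so all differences vanish, and 0 does
    not divide 2. This lets one congruence argument serve both cases. *)
Lemma hcf_chi_gt2 :
    ~~ hcf_chi_le H 2 ->
  exists2 d, ~~ (d %| 2) &
    forall f : {ffun H -> 'I_2}, proper_coloring f -> d %| class_diff f.
Proof.
have memD (f : {ffun H -> 'I_2}) : proper_coloring f -> class_diff f \in diff_set H.
  by move=> cf; rewrite mem_undup; apply: image_f.
rewrite /hcf_chi_le /hcf_chi; case: eqP => [D0 _ | _ d_gt2].
  by exists 0 => // f /memD; rewrite D0 inE => /eqP->.
set d := \big[_/_]_(_ <- _) _ in d_gt2.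
exists d => [|f /memD]; first by apply: contra d_gt2 => /dvdn_leq; apply.
rewrite /d; elim: (diff_set H) => // a s IHs; rewrite inE big_cons.
case/predU1P=> [-> | /IHs]; first exact: dvdn_gcdl.
by apply: dvdn_trans; exact: dvdn_gcdr.
Qed.

Lemma bipartition_eqmod d A :
    (forall f : {ffun H -> 'I_2}, proper_coloring f -> d %| class_diff f) ->
  independent A -> independent (~: A) -> #|A| = #|~: A| %[mod d].
Proof.
move=> d_dvd iA iC; have [f [/d_dvd + fA fC]] := bipartition_coloring iA iC.
rewrite /class_diff fA fC; case: (leqP #|A| #|~: A|) => [le | /ltnW le].
  by rewrite -eqn_mod_dvd // => /eqP.
by rewrite -eqn_mod_dvd // => /eqP.
Qed.

(** A set closed under adjacency is a union of components: each component contributes to [#|A|]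
    either nothing or its whole size. *)
Lemma hcf_c_dvd_closed A :
  (forall x y, edge x y -> (x \in A) = (y \in A)) -> hcf_c H %| #|A|.
Proof.
move=> clA.
have eqv : {in [set: H] & &, equivalence_rel (connect (@edge H))}.
  move=> x y z _ _ _; split=> // cxy.
  exact: (same_connect (sym_connect_sym (@edge_sym H)) cxy).
have part := equivalence_partitionP eqv.
rewrite -sum1_card -[X in _ %| X]/(\sum_(x in A) 1).
rewrite (eq_bigl (fun x => (x \in [set: H]) && (x \in A))); last by move=> x; rewrite !inE.
rewrite (set_partition_big_cond _ part) /=; apply: dvdn_sum => C CH.
have [/existsP[x /andP[xC xA]] | noC] := boolP [exists x in C, x \in A]; last first.
  rewrite big1 // => x /andP[xC xA].
  by case/negP: noC; apply/existsP; exists x; rewrite xC.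
rewrite (eq_bigl (mem C)).
  by rewrite sum1_card; apply: (@biggcdn_inf _ C).
move=> y; apply: andb_idr => yC.
case/imsetP: CH xC yC => z _ ->; rewrite !inE => czx czy.
by rewrite -(closed_connect clA czy) (closed_connect clA czx).
Qed.

Hypothesis chiH : chromatic_number H = 2.

(** Minimality of 2 colors excludes 0 colors, so H has a vertex, and 1 color, so no color class is
    empty. The two classes of a proper coloring add up to [#|H|], which gives the upper bound. *)
Lemma sigma_bounds : 0 < sigma H /\ 2 * sigma H <= #|H|.
Proof.
move: chiH; rewrite /chromatic_number; case: ex_minnP => k colk mink Dk; subst k.
have [f cf] := existsP colk.
have H_gt0 : 0 < #|H|.
  rewrite lt0n; apply/negP=> /eqP/card0_eq H0.
  suff /mink : colorable H 0 by [].
  have g (x : H) : 'I_0 by have := H0 x.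
  by apply/existsP; exists (finfun g); apply/coloringP=> x; have := H0 x.
split; last first.
  have := sigma_le_color_class ord0 cf; have := sigma_le_color_class ord_max cf.
  by rewrite -(card_color_classes f); lia.
(* The default [#|H|] of both minima is positive by [H_gt0], so only the actual classes remain. *)
rewrite /sigma; apply: (big_ind (fun s => 0 < s)) => // [s t *|g cg].
  by rewrite leq_min; apply/andP.
apply: (big_ind (fun s => 0 < s)) => // [s t *|c _].
  by rewrite leq_min; apply/andP.
rewrite lt0n cards_eq0 /color_class; apply/negP=> /eqP c0.
(* If class [c] is empty, [g] is constant, so H has no edge. *)
suff /mink : colorable H 1 by [].
apply/existsP; exists [ffun=> ord0]; apply/coloringP=> x y exy.
have /negP := coloringP _ cg _ _ exy; case.
have gc z : g z != c by apply/negP=> gz; have := in_set0 z; rewrite -c0 inE gz.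
move: (gc x) (gc y); rewrite -!val_eqE /=.
by case: (g x) (g y) c {c0 gc} => [[|[|?]] ?] [[|[|?]] ?] [[|[|?]] ?].
Qed.

Lemma one_minus_inv_chi_cr :
  (1 - 1 / chi_cr H = (sigma H)%:R / #|H|%:R)%R.
Proof.
have [s_gt0 s_le] := sigma_bounds.
rewrite /chi_cr chiH; have [h0 hs] : (#|H|%:R != 0 :> rat /\ #|H|%:R - (sigma H)%:R != 0 :> rat)%R.
  by rewrite -natrB ?pnatr_eq0; lia.
by field; rewrite hs h0.
Qed.

End Bipartitions.

(** * Factors as tilings *)

Section Factors.
Variables (H G : sgraph) (m : nat).
Hypotheses (H_gt0 : 0 < #|H|) (cardG : #|G| = m * #|H|).

(** As [#|H|] divides [#|G|], no vertex is left over: the joint map from ['I_m * H] to G is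
    injective between sets of equal size, hence bijective, and S can be counted tile by tile. *)
Lemma factor_tiling :
    has_factor H G ->
  exists2 phi : 'I_m -> H -> G, forall i, copy_of (phi i) &
    forall S : {set G}, #|S| = \sum_i #|phi i @^-1: S|.
Proof.
rewrite /has_factor cardG mulnK // => -[phi [cphi dphi]]; exists phi => // S.
pose F (p : 'I_m * H) := phi p.1 p.2.
have injF : injective F.
  move=> [i x] [j y]; rewrite /F /= => eqF.
  have [ij | /dphi dij] := eqVneq i j; first by subst j; rewrite ((cphi i).1 _ _ eqF).
  by have := disjointFr dij (codom_f (phi i) x); rewrite eqF codom_f.
have bijF : bijective F by apply: inj_card_bij injF _; rewrite card_prod card_ord cardG.
rewrite -(on_card_preimset (onW_bij _ bijF)) -sum1_card.
rewrite (eq_bigl (fun p => predT p.1 && (phi p.1 p.2 \in S))) => [|p]; last by rewrite inE.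
rewrite -(pair_big_dep predT (fun i x => phi i x \in S) (fun _ _ => 1)) /=.
by apply: eq_bigr => i _; rewrite sum1dep_card.
Qed.

Lemma independent_preimset (f : H -> G) (S : {set G}) :
  copy_of f -> independent S -> independent (f @^-1: S).
Proof.
move=> [_ ef] /independentP iS; apply/independentP=> x y; rewrite !inE => xS yS.
by apply: contra (iS _ _ xS yS); apply: ef.
Qed.

Lemma factor_sigma_le (S : {set G}) :
    has_factor H G -> independent S -> independent (~: S) -> m * sigma H <= #|S|.
Proof.
move=> /factor_tiling[phi cphi cardS] iS iC; rewrite cardS -[m in m * _]card_ord -sum_nat_const.
apply: leq_sum => i _; apply: sigma_le_bipartition; last rewrite -preimsetC.
  exact: independent_preimset.
exact: independent_preimset.
Qed.

Lemma factor_eqmod d (S : {set G}) :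
    (forall f : {ffun H -> 'I_2}, proper_coloring f -> d %| class_diff f) ->
    has_factor H G -> independent S -> independent (~: S) ->
  #|S| = #|~: S| %[mod d].
Proof.
move=> d_dvd /factor_tiling[phi cphi cardS] iS iC; rewrite !cardS -modn_summ -[RHS]modn_summ.
congr (_ %% d); apply: eq_bigr => i _; rewrite preimsetC.
by apply: bipartition_eqmod => //; rewrite -?preimsetC; exact: independent_preimset.
Qed.

Lemma factor_hcf_c_dvd (S : {set G}) :
    has_factor H G -> (forall x y, edge x y -> (x \in S) = (y \in S)) ->
  hcf_c H %| #|S|.
Proof.
move=> /factor_tiling[phi cphi ->] clS; apply: dvdn_sum => i _.
by apply: hcf_c_dvd_closed => x y /((cphi i).2)/clS; rewrite !inE.
Qed.

End Factors.

(** * The extremal graphs *)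

Section TwoBicliques.
Variables (n a b : nat).

(** Membership in the first biclique K(a, b), which has its b vertices on side [true] and its a
    vertices on side [false]. *)
Definition block (x : bool * 'I_n) : bool := x.2 < (if x.1 then b else a).

Definition two_bicliques_rel : rel (bool * 'I_n) :=
  fun x y => (x.1 != y.1) && (block x == block y).

Lemma two_bicliques_sym : symmetric two_bicliques_rel.
Proof. by move=> x y; rewrite /two_bicliques_rel eq_sym [block x == _]eq_sym. Qed.

Lemma two_bicliques_irr : irreflexive two_bicliques_rel.
Proof. by move=> x; rewrite /two_bicliques_rel eqxx. Qed.

(* The disjoint union of the complete bipartite graphs K(a, b) and
   K(n - a, n - b); the boolean is the side of the balanced bipartition. *)
Definition two_bicliques : sgraph := SGraph two_bicliques_sym two_bicliques_irr.

Lemma card_two_bicliques : #|two_bicliques| = 2 * n.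
Proof. by rewrite card_prod card_bool card_ord. Qed.

Definition side_set : {set two_bicliques} := [set x | x.1].
Definition block_set : {set two_bicliques} := [set x | block x].
(** One class of the second bipartition: [side_set] with the two sides of the first biclique
    exchanged. *)
Definition crossing_set : {set two_bicliques} := [set x | x.1 != block x].

Lemma two_bicliques_balanced : balanced_bipartite two_bicliques.
Proof.
exists side_set; split.
- by apply/independentP=> -[s i] [t j]; rewrite !inE /= => s1 t1; rewrite /two_bicliques_rel /= s1 t1.
- apply/independentP=> -[s i] [t j]; rewrite !inE /= => /negbTE-> /negbTE->.
  by rewrite /two_bicliques_rel.
rewrite /side_set; have -> : ~: [set x : two_bicliques | x.1] = [set x | ~~ x.1].
  by apply/setP=> x; rewrite !inE.
by rewrite !card_bool_prod /= !cardsT !cards0 addnC.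
Qed.

Lemma block_set_closed (x y : two_bicliques) :
  edge x y -> (x \in block_set) = (y \in block_set).
Proof. by rewrite !inE => /andP[_ /eqP]. Qed.

Lemma independent_crossing : independent crossing_set.
Proof.
apply/independentP=> x y; rewrite !inE => xS yS; apply/negP=> /andP[/= ne /eqP eqb].
by move: xS yS ne; rewrite eqb; case: x.1; case: y.1; case: (block y).
Qed.

Lemma independent_crossingC : independent (~: crossing_set).
Proof.
apply/independentP=> x y; rewrite !inE => xS yS; apply/negP=> /andP[/= ne /eqP eqb].
by move: xS yS ne; rewrite eqb; case: x.1; case: y.1; case: (block y).
Qed.

Hypotheses (le_an : a <= n) (le_bn : b <= n).

Lemma card_block_set : #|block_set| = a + b.
Proof. by rewrite card_bool_prod /block /= !card_ord_lt // addnC. Qed.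

Lemma card_crossing : #|crossing_set| = a + (n - b).
Proof.
rewrite card_bool_prod /block /=.
rewrite (_ : [set i : 'I_n | true != _] = [set i : 'I_n | ~~ (i < b)]); last first.
  by apply/setP=> i; rewrite !inE; case: (i < b).
rewrite (_ : [set i : 'I_n | false != _] = [set i : 'I_n | i < a]); last first.
  by apply/setP=> i; rewrite !inE; case: (i < a).
by rewrite card_ord_lt // card_ord_ge // addnC.
Qed.

Lemma card_crossingC : #|~: crossing_set| = (n - a) + b.
Proof. by rewrite cardsCs setCK card_crossing card_two_bicliques; lia. Qed.

Lemma two_bicliques_degree (x : two_bicliques) :
  degree x = let s := if x.1 then a else b in if block x then s else n - s.
Proof.
have no_nbr : #|[set j : 'I_n | false]| = 0 by apply: eq_card0 => j; rewrite inE.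
case: x => s i; rewrite /degree card_bool_prod /= /two_bicliques_rel /=.
case: s => /=; rewrite /block /= no_nbr ?addn0 ?add0n.
  case: (i < b) => /=.
    by rewrite -[RHS](card_ord_lt le_an); apply: eq_card => j; rewrite !inE.
  by rewrite -(card_ord_ge le_an); apply: eq_card => j; rewrite !inE; case: (j < a).
case: (i < a) => /=.
  by rewrite -[RHS](card_ord_lt le_bn); apply: eq_card => j; rewrite !inE.
by rewrite -(card_ord_ge le_bn); apply: eq_card => j; rewrite !inE; case: (j < b).
Qed.

(** The possible degrees are a, b, n - a and n - b, and the hypotheses make a the least. Positivity
    of b provides a vertex of degree a, on side [true] of the first biclique. *)
Lemma two_bicliques_min_degree :
  0 < b -> a <= b -> a + b <= n -> min_degree two_bicliques = a.
Proof.
move=> b_gt0 le_ab le_abn; apply/eqP; rewrite eqn_leq; apply/andP; split.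
  have n_gt0 : 0 < n by lia.
  pose x : two_bicliques := (true, Ordinal n_gt0).
  have -> : a = degree x by rewrite two_bicliques_degree /= /block /= b_gt0.
  exact: (bigmin_le_cond _ (@degree two_bicliques) (isT : xpredT x)).
apply: (big_ind (fun s => a <= s)) => [|s t *|x _].
(* The default value of the minimum is the number of vertices, 2n. *)
- by rewrite card_two_bicliques; lia.
- by rewrite leq_min; apply/andP.
- by rewrite two_bicliques_degree /=; case: ifP => _; case: ifP => _; lia.
Qed.

End TwoBicliques.

(** * Choice of the parameters *)

Theorem proposition1p3 (H : sgraph) (m n : nat)
    (chiH : chromatic_number H = 2) (m_gt0 : 0 < m)
    (def_n : 2 * n = m * #|H|) :
  (~~ hcf_eq1 H ->
     exists G : sgraph,
       [/\ balanced_bipartite G, #|G| = 2 * n,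
           ((min_degree G)%:Z = Num.ceil (n%:R / 2%:R : rat) - 1)%R
         & ~ has_factor H G])
  /\
  (hcf_eq1 H ->
     exists G : sgraph,
       [/\ balanced_bipartite G, #|G| = 2 * n,
           ((min_degree G)%:Z = Num.ceil ((1 - 1 / chi_cr H) * n%:R) - 1)%R
         & ~ has_factor H G]).
Proof.
have [s_gt0 s_le] := sigma_bounds chiH.
have H_gt0 : 0 < #|H| by lia.
have n_gt0 : 0 < n by nia.
have cardG a b : #|two_bicliques n a b| = m * #|H| by rewrite card_two_bicliques.
split=> [|_]; last first.
  have sm_gt0 : 0 < sigma H * m by rewrite muln_gt0 s_gt0.
  have -> : ((1 - 1 / chi_cr H) * n%:R = (sigma H * m)%:R / 2%:R :> rat)%R.
    rewrite one_minus_inv_chi_cr // natrM.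
    have h0 : (#|H|%:R != 0 :> rat)%R by rewrite pnatr_eq0; lia.
    have /(congr1 (fun k => k%:R : rat)%R) := def_n; rewrite !natrM => dn.
    have -> : (n%:R = m%:R * #|H|%:R / 2 :> rat)%R by rewrite -dn; field.
    by field.
  set k := (sigma H * m).-1./2.
  have k_lt : 2 * k < sigma H * m by rewrite /k; lia.
  (* 2k < m sigma(H) <= m h / 2 = n, so b = n - k is positive and at least k. *)
  have k_le : 2 * k < n by nia.
  exists (two_bicliques n k (n - k)); split.
  - exact: two_bicliques_balanced.
  - exact: card_two_bicliques.
  - by rewrite two_bicliques_min_degree; [exact: ceil_half | lia..].
  move=> factG.
  have := factor_sigma_le H_gt0 (cardG _ _) factG
    (independent_crossing n k (n - k)) (independent_crossingC n k (n - k)).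
  by rewrite card_crossing; lia.
set k := n.-1./2; have k_lt : 2 * k + 1 <= n by rewrite /k; lia.
(* Only b remains to be chosen, between k and n - k. *)
have main b : 0 < b -> k <= b -> k + b <= n ->
    ~ has_factor H (two_bicliques n k b) ->
  exists G : sgraph,
    [/\ balanced_bipartite G, #|G| = 2 * n,
        ((min_degree G)%:Z = Num.ceil (n%:R / 2%:R : rat) - 1)%R
      & ~ has_factor H G].
  move=> b_gt0 le_kb le_kbn noF; exists (two_bicliques n k b); split=> //.
  - exact: two_bicliques_balanced.
  - exact: card_two_bicliques.
  - by rewrite two_bicliques_min_degree; [exact: ceil_half | lia..].
rewrite negb_and => /orP[c_neq1 | /hcf_chi_gt2[d d_ndvd d_dvd]].
  have [c_dvd | c_ndvd] := boolP (hcf_c H %| n).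
    (* For n = 1 the choice of b below would be 0; but then [hcf_c H] would divide 1. *)
    have n_gt1 : 1 < n.
      rewrite ltn_neqAle n_gt0 andbT; apply: contra c_neq1 => /eqP n1.
      by rewrite -n1 dvdn1 in c_dvd.
    (* The first biclique now has n - 1 vertices, and a common divisor of n and n - 1 is 1. *)
    apply: (main (n - k).-1); [lia.. | move=> factG].
    have := factor_hcf_c_dvd H_gt0 (cardG _ _) factG (@block_set_closed _ _ _).
    rewrite card_block_set; [|lia..].
    rewrite (_ : k + _ = n.-1); last by lia.
    move=> c_dvd_pred; move: c_dvd.
    by rewrite -(prednK n_gt0) -addn1 dvdn_addr // dvdn1 (negbTE c_neq1).
  (* Here the first biclique has n vertices. *)
  apply: (main (n - k)); [lia.. | move=> factG].
  have := factor_hcf_c_dvd H_gt0 (cardG _ _) factG (@block_set_closed _ _ _).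
  rewrite card_block_set; [|lia..].
  by rewrite subnKC ?(negbTE c_ndvd) //; lia.
(* The classes of the crossing bipartition have n - 1 and n + 1 vertices. *)
apply: (main k.+1); [lia.. | move=> factG].
have := factor_eqmod H_gt0 (cardG _ _) d_dvd factG
  (independent_crossing _ _ _) (independent_crossingC _ _ _).
rewrite card_crossing ?card_crossingC; [|lia..].
move/esym/eqP; rewrite eqn_mod_dvd; last by lia.
by rewrite (_ : _ - _ = 2) ?(negbTE d_ndvd) //; lia.
Qed.
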